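(* Let $H$ be a (fixed) graph and let $F$ be a (fixed) graph with chromatic number $k$. Then, as $n\to\infty$, \[ \mathrm{ex}(n,H,F) \leq \mathrm{ex}(n,H,K_k) + o(n^{|H|}). \]
   Context: All graphs are finite and simple. A graph $G$ is $F$-free if it contains no copy of $F$ as a (not necessarily induced) subgraph. A copy of $H$ in $G$ is a subgraph of $G$ isomorphic to $H$. $\mathrm{ex}(n,H,F)$ denotes the maximum number of copies of $H$ in an $n$-vertex $F$-free graph. $|H|$ denotes the number of vertices of $H$, and $K_k$ is the complete graph on $k$ vertices. *)

(* Defs.v *)
From HB Require Import structures.
From mathcomp Require Import all_boot all_order all_algebra.

Set Implicit Arguments.
Unset Strict Implicit.
Unset Printing Implicit Defensive.

(* The simple graphs with vertex type V, given by their edge sets. *)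
Record sgraph (V : finType) := SGraph {
  edges : {set {set V}};
  edges_card2 : [forall e in edges, #|e| == 2] }.

HB.instance Definition _ (V : finType) := [isSub for @edges V].
HB.instance Definition _ (V : finType) := [Finite of sgraph V by <:].

Section Graphs.
Variables (V W : finType).

Definition adj (G : sgraph V) : rel V := fun x y => [set x; y] \in edges G.

(* A subgraph is a pair (vertex set, edge set); the vertex set is recorded
   because H may have isolated vertices. *)
Definition subgraph (G : sgraph W) (S : {set W} * {set {set W}}) : bool :=
  (S.2 \subset edges G) && [forall e in S.2, e \subset S.1].

(* f is an isomorphism from H onto the graph (S.1, S.2). *)
Definition is_iso (H : sgraph V) (S : {set W} * {set {set W}})
    (f : {ffun V -> W}) : bool :=
  [&& injectiveb f, f @: [set: V] == S.1
    & [forall x, forall y, adj H x y == ([set f x; f y] \in S.2)]].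

Definition copies (H : sgraph V) (G : sgraph W) :
    {set {set W} * {set {set W}}} :=
  [set S | subgraph G S && [exists f, is_iso H S f]].

Definition free (F : sgraph V) (G : sgraph W) : bool := copies F G == set0.

Definition colorable (G : sgraph V) (k : nat) : bool :=
  [exists c : {ffun V -> 'I_k}, forall x, forall y, adj G x y ==> (c x != c y)].

Lemma adj_irrefl (G : sgraph V) : irreflexive (adj G).
Proof.
move=> x; apply/negP => /(forall_inP (edges_card2 G)).
by rewrite setUid cards1.
Qed.

Lemma colorable_exists (G : sgraph V) : exists k, colorable G k.
Proof.
exists #|V|; apply/existsP; exists [ffun x => enum_rank x].
apply/forallP => x; apply/forallP => y; apply/implyP => xy; rewrite !ffunE.
by apply: contraTneq xy => /enum_rank_inj ->; rewrite adj_irrefl.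
Qed.

Definition chromatic_number (G : sgraph V) : nat :=
  ex_minn (colorable_exists G).

End Graphs.

Lemma complete_card2 (k : nat) :
  [forall e in [set e : {set 'I_k} | #|e| == 2], #|e| == 2].
Proof. by apply/forall_inP => e; rewrite inE. Qed.

Definition complete (k : nat) : sgraph 'I_k := SGraph (complete_card2 k).

(* ex(n, H, F). Every n-vertex graph is isomorphic to one on 'I_n. The value is
   0 if no n-vertex graph is F-free, which for large n happens exactly when
   F has no edge. *)
Definition ex_copies (n : nat) (V W : finType) (H : sgraph V) (F : sgraph W) :
    nat :=
  \max_(G : sgraph 'I_n | free F G) #|copies H G|.

(* Main.v *)
Require Import Defs.
From mathcomp Require Import all_boot all_order all_algebra.
From mathcomp Require Import all_classical all_reals all_analysis.
From mathcomp Require Import fintype finset zify ring lra.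
Import Order.TTheory GRing.Theory Num.Theory.
Import numFieldNormedType.Exports.

Set Implicit Arguments.
Unset Strict Implicit.
Unset Printing Implicit Defensive.

(** Write [h] and [k] for the number of vertices of [H] and the chromatic
    number of [F]. The proof is a supersaturation argument in two halves; it
    needs no removal lemma.

    Sampling. Instead of copies of [H] it is convenient to count embeddings
    (injective adjacency-preserving maps); their number is the number of copies
    times the constant [num_aut H] ([card_embeddings]). Pull a graph [G] on [n]
    vertices back along a uniformly random map from [m] points to its vertices,
    with [m] fixed. The image of any fixed [h]-tuple of distinct sample points is
    a uniformly random [h]-tuple of vertices, so the expected number of
    embeddings of [H] in the pullback is [m ^_ h] times the density of
    embeddings of [H] in [G]. A pullback without [K_k] has at most
    [num_aut H * ex_copies m H K_k] of them, and a pullback containing [K_k] is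
    rare when [G] has few copies of [K_k]. Hence a graph with [o(n ^ k)] copies
    of [K_k] has density of embeddings of [H] at most
    [num_aut H * ex_copies m H K_k / m ^_ h + o(1)] ([embedding_averaging]).
    Taking [m] fixed with this ratio close to its infimum over all [m >= h], one
    may replace it by the same ratio at [n], which is at least that infimum.

    Few cliques. An [F]-free graph does have only [o(n ^ k)] copies of [K_k].
    By a theorem of Erdos ([box_of_positive_density]), a positive proportion of
    all [k]-tuples contains a box, the set of all choices of one element from
    each of [k] sets of prescribed size. If all the tuples are cliques, the box
    is a complete [k]-partite graph with parts as large as [F], and any proper
    [k]-colouring of [F] embeds [F] into it ([blowup_not_free]). *)

(** * Copies and embeddings *)

Section Embeddings.
Variables (V W : finType).

Definition embeddings (H : sgraph V) (G : sgraph W) : {set {ffun V -> W}} :=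
  [set f : {ffun V -> W} | injectiveb f
     && [forall x, forall y, adj H x y ==> adj G (f x) (f y)]].

Lemma embeddingP (H : sgraph V) (G : sgraph W) (f : {ffun V -> W}) :
  reflect (injective f /\ forall x y, adj H x y -> adj G (f x) (f y))
          (f \in embeddings H G).
Proof.
rewrite inE; apply: (iffP andP) => [[/injectiveP fI fH]|[fI fH]].
  by split=> // x y; move/forallP/(_ x)/forallP/(_ y)/implyP: fH.
split; first exact/injectiveP.
by apply/forallP => x; apply/forallP => y; apply/implyP/fH.
Qed.

Definition embedded_copy (H : sgraph V) (f : {ffun V -> W}) :
    {set W} * {set {set W}} :=
  (f @: [set: V], [set f @: e | e : {set V} in edges H]).

End Embeddings.

Lemma adj_sym (V : finType) (G : sgraph V) : symmetric (adj G).
Proof. by move=> x y; rewrite /adj setUC. Qed.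

Lemma adj_neq (V : finType) (G : sgraph V) x y : adj G x y -> x != y.
Proof. by apply: contraTneq => ->; rewrite adj_irrefl. Qed.

Lemma edge_pair (V : finType) (G : sgraph V) (e : {set V}) :
  e \in edges G -> exists x y, e = [set x; y] /\ adj G x y.
Proof.
move=> eG; have /cards2P[x [y [_ eE]]] := forall_inP (edges_card2 G) e eG.
by exists x, y; rewrite /adj -eE.
Qed.

Lemma embedded_copy_adj (V W : finType) (H : sgraph V) (f : {ffun V -> W}) x y :
  injective f -> ([set f x; f y] \in (embedded_copy H f).2) = adj H x y.
Proof.
move=> fI; rewrite -[[set f x; f y]](_ : f @: [set x; y] = _); last first.
  by rewrite imsetU !imset_set1.
by apply/imsetP/idP => [[e eH /(imset_inj fI) eE]|xy]; [rewrite /adj eE|exists [set x; y]].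
Qed.

(** Edges of a copy *)
(** A copy of [H] is determined by any isomorphism onto it: an edge of the copy is
    an edge of [G] with both ends in the image of [f], hence the image of a pair,
    and [f] tells whether that pair is an edge of [H]. *)
Lemma is_isoE (V W : finType) (H : sgraph V) (G : sgraph W) S f :
  subgraph G S -> is_iso H S f -> injective f /\ S = embedded_copy H f.
Proof.
case: S => A E /andP[/= /subsetP EG /forall_inP EA] /and3P[/injectiveP fI /eqP/= fA].
move=> /forallP fE; split=> //; congr pair; first by [].
have {}fE x y : adj H x y = ([set f x; f y] \in E).
  by move/forallP/(_ y)/eqP: (fE x).
apply/setP => e; apply/idP/imsetP => [eE|[e' /edge_pair[x [y [-> xy]]] ->]].
  have [u [v [eE2 _]]] := edge_pair (EG _ eE).
  have := EA _ eE; rewrite eE2 subUset !sub1set -fA.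
  case/andP=> /imsetP[x _ ux] /imsetP[y _ vy].
  exists [set x; y]; last by rewrite imsetU !imset_set1 ux vy.
  by have := fE x y; rewrite /adj => ->; rewrite -ux -vy -eE2.
by rewrite imsetU !imset_set1 -fE.
Qed.

Lemma embedded_copyP (V W : finType) (H : sgraph V) (G : sgraph W) f :
  f \in embeddings H G ->
  embedded_copy H f \in copies H G /\ is_iso H (embedded_copy H f) f.
Proof.
case/embeddingP => fI fH.
have iso : is_iso H (embedded_copy H f) f.
  apply/and3P; split; [exact/injectiveP | by [] |].
  apply/forallP => x; apply/forallP => y.
  by rewrite embedded_copy_adj.
split=> //; rewrite inE; apply/andP; split; last by apply/existsP; exists f.
apply/andP; split.
  apply/subsetP => _ /imsetP[e /edge_pair[x [y [-> xy]]] ->].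
  by rewrite imsetU !imset_set1; exact: fH.
by apply/forall_inP => _ /imsetP[e _ ->]; apply: imsetS; apply: subsetT.
Qed.

Lemma is_iso_embedding (V W : finType) (H : sgraph V) (G : sgraph W) S f :
  subgraph G S -> is_iso H S f -> f \in embeddings H G.
Proof.
move=> SG Sf; have [fI _] := is_isoE SG Sf; apply/embeddingP; split=> // x y xy.
case/and3P: Sf => _ _ /forallP/(_ x)/forallP/(_ y)/eqP; rewrite xy => /esym.
by case/andP: SG => /subsetP SG _ /SG.
Qed.

(** The automorphisms of [H], viewed as the isomorphisms from [H] onto itself as a
    subgraph, so that they are the case of the identity copy in [card_isos]. *)
Definition num_aut (V : finType) (H : sgraph V) :=
  #|[set f : {ffun V -> V} | is_iso H (embedded_copy H [ffun x => x]) f]|.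

(** The isomorphisms onto one copy form a torsor under the automorphisms of [H]:
    composing a fixed one, [f0], with all automorphisms gives each exactly once. *)
Lemma card_isos (V W : finType) (H : sgraph V) (G : sgraph W) S :
  S \in copies H G -> #|[set f | is_iso H S f]| = num_aut H.
Proof.
rewrite inE => /andP[SG /existsP[f0 f0S]].
have [f0I SE] := is_isoE SG f0S.
pose c (s : {ffun V -> V}) := [ffun x => f0 (s x)].
have cI : injective c.
  by move=> s s' /ffunP sE; apply/ffunP => x; move: (sE x); rewrite !ffunE => /f0I.
rewrite /num_aut -(card_imset _ cI); congr #|pred_of_set _|.
have idI : injective ([ffun x => x] : {ffun V -> V}) by move=> x y; rewrite !ffunE.
have adjS x y : ([set f0 x; f0 y] \in S.2) = adj H x y.
  by rewrite SE embedded_copy_adj.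
have adjI x y : ([set x; y] \in (embedded_copy H [ffun x => x]).2) = adj H x y.
  by rewrite -(embedded_copy_adj H x y idI) !ffunE.
apply/setP => f; rewrite inE; apply/idP/imsetP => [fS|[s]].
  have [fI _] := is_isoE SG fS.
  have fim x : f x \in codom f0.
    have : f x \in S.1 by case/and3P: fS => _ /eqP <- _; apply: imset_f.
    case/and3P: f0S => _ /eqP <- _ /imsetP[y _ ->]; exact: codom_f.
  exists [ffun x => iinv (fim x)]; last first.
    by apply/ffunP => x; rewrite !ffunE f_iinv.
  have sI : injective [ffun x => iinv (fim x)].
    by move=> x y; rewrite !ffunE => /(congr1 f0); rewrite !f_iinv => /fI.
  rewrite inE; apply/and3P; split; first exact/injectiveP.
    apply/eqP/setP => x; rewrite /=.
    have -> : x \in [set [ffun x0 => iinv (fim x0)] x0 | x0 in [set: V]].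
      by rewrite -[x](f_invF sI) imset_f.
    by apply/esym/imsetP; exists x; rewrite ?ffunE.
  apply/forallP => x; apply/forallP => y.
  case/and3P: fS => _ _ /forallP/(_ x)/forallP/(_ y)/eqP ->.
  by rewrite adjI !ffunE -adjS !f_iinv.
rewrite inE => /and3P[/injectiveP sI _ /forallP sE] ->.
apply/and3P; split.
- by apply/injectiveP => x y; rewrite !ffunE => /f0I/sI.
- case/and3P: f0S => _ /eqP <- _; apply/eqP/setP => w.
  apply/imsetP/imsetP => -[x _ ->]; first by exists (s x); rewrite ?ffunE.
  by exists (invF sI x); rewrite ?ffunE ?f_invF.
- apply/forallP => x; apply/forallP => y; move/forallP/(_ y)/eqP: (sE x) => ->.
  by rewrite adjI !ffunE adjS.
Qed.

Lemma num_aut_gt0 (V : finType) (H : sgraph V) : 0 < num_aut H.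
Proof.
have: [ffun x => x] \in embeddings H H.
  by apply/embeddingP; split=> x y; rewrite !ffunE.
by case/embedded_copyP => _ iso; rewrite card_gt0; apply/set0Pn;
  exists [ffun x => x]; rewrite inE.
Qed.

Lemma card_embeddings (V W : finType) (H : sgraph V) (G : sgraph W) :
  #|embeddings H G| = num_aut H * #|copies H G|.
Proof.
rewrite -sum1_card (partition_big (embedded_copy H) (mem (copies H G))) /=; last first.
  by move=> f /embedded_copyP[].
rewrite mulnC -sum_nat_const; apply: eq_bigr => S SG.
rewrite -(card_isos SG) -sum1dep_card; apply: eq_bigl => f.
have SG' : subgraph G S by move: SG; rewrite inE => /andP[].
apply/andP/idP => [[/embedded_copyP[_ iso] /eqP <-] //|iso].
by split; [exact: is_iso_embedding iso | have [_ ->] := is_isoE SG' iso].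
Qed.

Lemma freeE (V W : finType) (H : sgraph V) (G : sgraph W) :
  Defs.free H G = (embeddings H G == set0).
Proof.
rewrite /Defs.free -!cards_eq0 card_embeddings muln_eq0 orbC.
by rewrite [num_aut H == 0]eqn0Ngt num_aut_gt0 orbF.
Qed.

(** * Sampling by random pullbacks *)

(** If [phi] is a uniformly random map [M -> T] and [psi] is injective, then
    [phi \o psi] is a uniformly random map [A -> T]: the values of [phi] outside the
    image of [psi] are free. Stated without division. *)
Lemma card_precomp_inj (A M T : finType) (psi : A -> M) (Q : {set {ffun A -> T}}) :
  injective psi ->
  #|[set phi : {ffun M -> T} | [ffun x => phi (psi x)] \in Q]| * #|T| ^ #|A|
    = #|Q| * #|T| ^ #|M|.
Proof.
move=> psiI; pose c (phi : {ffun M -> T}) := [ffun x => phi (psi x)].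
rewrite -[X in X * _]sum1_card (partition_big c (mem Q)) /=; last first.
  by move=> phi; rewrite inE.
rewrite big_distrl /= -[RHS]sum_nat_const; apply: eq_bigr => g gQ.
pose F y : pred T := [pred z | [forall x, (psi x == y) ==> (z == g x)]].
have -> : \sum_(phi in [set phi | c phi \in Q] | c phi == g) 1
          = \prod_y #|F y|.
  rewrite -[RHS](_ : #|family F| = _); last first.
    by rewrite card_family foldrE big_map -big_enum.
  rewrite sum1dep_card -(cardsE (family F)); congr #|pred_of_set _|; apply/setP => phi.
  rewrite !inE; apply/andP/familyP => [[_ /eqP/ffunP phiE] y|phiE].
    by rewrite inE; apply/forallP => x; apply/implyP => /eqP <-; rewrite -phiE ffunE.
  have -> : c phi = g; last by [].
  apply/ffunP => x; rewrite ffunE.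
  by have /forallP/(_ x) := phiE (psi x); rewrite eqxx => /eqP.
have -> : #|T| ^ #|A| = \prod_y (if y \in codom psi then #|T| else 1).
  by rewrite -big_mkcond prod_nat_const /= card_codom.
rewrite -big_split /= -prod_nat_const; apply: eq_bigr => y _.
case: ifPn => [/codomP[x ->]|yN]; last first.
  rewrite muln1; apply: eq_card => z; rewrite !inE.
  by apply/forallP => x; apply/implyP => /eqP xy; rewrite -xy codom_f in yN.
rewrite -[RHS]mul1n -(card1 (g x)); congr (_ * _); apply: eq_card => z.
rewrite !inE; apply/forallP/eqP => [/(_ x)|-> x']; first by rewrite eqxx => /eqP.
by apply/implyP => /eqP/psiI ->.
Qed.

Section Pullback.
Variables (M T : finType) (G : sgraph T) (phi : M -> T).

Definition pullback_edges : {set {set M}} :=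
  [set e : {set M} | (#|e| == 2)
     && [forall x in e, forall y in e, (x != y) ==> adj G (phi x) (phi y)]].

Lemma pullback_card2 : [forall e in pullback_edges, #|e| == 2].
Proof. by apply/forall_inP => e; rewrite inE => /andP[]. Qed.

Definition pullback := SGraph pullback_card2.

Lemma adj_pullback x y : adj pullback x y = adj G (phi x) (phi y).
Proof.
rewrite {1}/adj inE; apply/andP/idP => [[xy xyP]|adjG].
  have /implyP := forall_inP (forall_inP xyP x (set21 x y)) y (set22 x y).
  by apply; move: xy; rewrite cards2; case: (x == y).
have xy : x != y.
  by apply: contraTneq (adj_neq adjG) => ->; rewrite eqxx.
split; first by rewrite cards2 xy.
apply/forall_inP => u; rewrite !inE => /orP[]/eqP-> ; apply/forall_inP => v;
  rewrite !inE => /orP[]/eqP->; apply/implyP; rewrite ?eqxx // => _.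
by rewrite adj_sym.
Qed.

End Pullback.

Lemma adj_complete k (i j : 'I_k) : adj (complete k) i j = (i != j).
Proof. by rewrite /adj inE cards2; case: (i == j). Qed.

Lemma leq_card_embeddings (V W : finType) (H : sgraph V) (G : sgraph W) :
  #|embeddings H G| <= #|W| ^_ #|V|.
Proof.
rewrite -card_inj_ffuns; apply: subset_leq_card; apply/subsetP => f.
by rewrite !inE => /andP[].
Qed.

Lemma free_card_embeddings (V W : finType) (H : sgraph V) (F : sgraph W) m
    (G : sgraph 'I_m) :
  Defs.free F G -> #|embeddings H G| <= num_aut H * ex_copies m H F.
Proof.
move=> FG; rewrite card_embeddings leq_mul2l; apply/orP; right.
exact: (leq_bigmax_cond (F := fun G : sgraph 'I_m => #|copies H G|)).
Qed.

Lemma leq_card_bigcup (I T : finType) (P : pred I) (A : I -> {set T}) :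
  #|\bigcup_(i | P i) A i| <= \sum_(i | P i) #|A i|.
Proof.
elim/big_rec2: _ => [|i m B _ IH]; first by rewrite cards0.
by apply: leq_trans (leq_card_setU _ _) _; rewrite leq_add2l.
Qed.

(** Union bound over the [m ^_ k] possible places of a clique in the sample. Any
    clique of the pullback is mapped to a clique of [G], injectively since [adj] is
    irreflexive. *)
Lemma card_pullback_complete (T : finType) (G : sgraph T) m k :
  #|[set phi : {ffun 'I_m -> T} | ~~ Defs.free (complete k) (pullback G phi)]|
      * #|T| ^ k
    <= m ^_ k * (#|embeddings (complete k) G| * #|T| ^ m).
Proof.
pose Q := embeddings (complete k) G.
pose I := [set psi : {ffun 'I_k -> 'I_m} | injectiveb psi].
have sub : [set phi : {ffun 'I_m -> T} | ~~ Defs.free (complete k) (pullback G phi)]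
   \subset \bigcup_(psi in I) [set phi : {ffun 'I_m -> T} | [ffun x => phi (psi x)] \in Q].
  apply/subsetP => phi; rewrite inE freeE => /set0Pn[psi /embeddingP[psiI psiH]].
  apply/bigcupP; exists psi; first by rewrite inE; apply/injectiveP.
  have adjQ i j : adj (complete k) i j -> adj G (phi (psi i)) (phi (psi j)).
    by move/psiH; rewrite adj_pullback.
  rewrite inE; apply/embeddingP; split=> [i j|i j ij]; rewrite !ffunE; last exact: adjQ.
  move=> ij; apply/eqP; apply: contraT; rewrite -adj_complete.
  by move=> /adjQ/adj_neq; rewrite ij eqxx.
have cardI : #|I| = m ^_ k by rewrite card_inj_ffuns !card_ord.
apply: leq_trans (leq_mul (subset_leq_card sub) (leqnn _)) _.
apply: leq_trans (leq_mul (leq_card_bigcup _ _) (leqnn _)) _.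
rewrite big_distrl /= -cardI -sum_nat_const; apply: leq_sum => psi.
rewrite inE => /injectiveP psiI.
by have := card_precomp_inj Q psiI; rewrite !card_ord => ->.
Qed.

(** After division by [#|T| ^ (#|V| + k)] this bounds the density of embeddings of
    [H] by the extremal number for [K_k] on [m] points, up to an error proportional
    to the density of [K_k]. The proof counts in two ways the pairs of a map
    [phi] to the vertices of [G] and an injection [psi] of [V] into the sample
    such that [phi \o psi] is an embedding. *)
Lemma embedding_averaging (V T : finType) (H : sgraph V) (G : sgraph T) m k :
  0 < #|T| ->
  m ^_ #|V| * #|embeddings H G| * #|T| ^ k
    <= #|T| ^ #|V| * (#|T| ^ k * (num_aut H * ex_copies m H (complete k))
                      + m ^_ k * #|embeddings (complete k) G| * m ^_ #|V|).
Proof.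
move=> T0; set h := #|V|; set n := #|T|; set e := num_aut H * _.
pose Q := embeddings H G.
pose I := [set psi : {ffun V -> 'I_m} | injectiveb psi].
have cardI : #|I| = m ^_ h by rewrite card_inj_ffuns !card_ord.
pose B := [set phi : {ffun 'I_m -> T} | ~~ Defs.free (complete k) (pullback G phi)].
pose S := \sum_(psi in I) #|[set phi : {ffun 'I_m -> T} | [ffun x => phi (psi x)] \in Q]|.
have SE : S * n ^ h = m ^_ h * (#|Q| * n ^ m).
  rewrite big_distrl /= -cardI -sum_nat_const; apply: eq_bigr => psi.
  by rewrite inE => /injectiveP psiI; have := card_precomp_inj Q psiI; rewrite !card_ord.
(* For a fixed [phi], each such [psi] embeds [H] in the pullback; when the
   pullback contains a clique, all [m ^_ h] injections are allowed for. *)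
have SB : S <= n ^ m * e + #|B| * m ^_ h.
  have -> : S = \sum_(phi : {ffun 'I_m -> T})
       #|[set psi : {ffun V -> 'I_m} in I | [ffun x => phi (psi x)] \in Q]|.
    under [RHS]eq_bigr do rewrite -sum1dep_card.
    rewrite (exchange_big_dep (mem I)) /=; last by move=> phi psi _ /andP[].
    by apply: eq_bigr => psi psiI; rewrite -sum1dep_card; apply: eq_bigl => phi; rewrite psiI.
  have -> : n ^ m = #|{ffun 'I_m -> T}| by rewrite card_ffun card_ord.
  rewrite -!sum_nat_const.
  rewrite [X in _ <= _ + X]big_mkcond -big_split /=; apply: leq_sum => phi _.
  apply: (@leq_trans #|embeddings H (pullback G phi)|).
    apply: subset_leq_card; apply/subsetP => psi; rewrite inE => /andP[].
    rewrite inE => /injectiveP psiI /embeddingP[_ psiH].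
    apply/embeddingP; split=> // x y xy; rewrite adj_pullback.
    by have := psiH _ _ xy; rewrite !ffunE.
  rewrite inE; case: ifPn => [_|]; last first.
    by rewrite negbK addn0 => /free_card_embeddings ->.
  apply: leq_trans (leq_addl _ _).
  by have := leq_card_embeddings H (pullback G phi); rewrite card_ord.
have BE := card_pullback_complete G m k; rewrite -/B -/n in BE.
have nm0 : 0 < n ^ m by rewrite expn_gt0 T0.
rewrite -(leq_pmul2r nm0).
have -> : m ^_ h * #|embeddings H G| * n ^ k * n ^ m = S * n ^ h * n ^ k.
  by rewrite SE -!mulnA; congr (_ * (_ * _)); rewrite mulnC.
apply: leq_trans (leq_mul (leq_mul SB (leqnn _)) (leqnn _)) _.
set N := #|embeddings _ _| in BE *; rewrite -/h.
have -> : (n ^ m * e + #|B| * m ^_ h) * n ^ h * n ^ k =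
  n ^ h * (n ^ k * e * n ^ m) + n ^ h * m ^_ h * (#|B| * n ^ k).
  rewrite !mulnDl; congr (_ + _); nia.
apply: leq_trans (leq_add (leqnn _) (leq_mul (leqnn _) BE)) _.
nia.
Qed.

(** * Boxes in dense sets of tuples *)

(** All but a proportion [h ^ 2 / n] of the [h]-tuples have distinct entries. *)
Lemma expn_ffact_gap n h : n * n ^ h <= n * n ^_ h + h ^ 2 * n ^ h.
Proof.
elim: h => [|h IH]; first by rewrite ffactn0 leq_addr.
rewrite ffactnSr expnS.
case: (leqP n h) => [nh|hn].
  apply: leq_trans (leq_addl _ _); rewrite leq_mul2r; apply/orP; right; nia.
have [d nE] : exists d, n = h + d by exists (n - h); rewrite subnKC // ltnW.
have -> : n - h = d by rewrite nE addKn.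
move: (n ^ h) (n ^_ h) IH => E F IH.
have IHd := leq_mul (leqnn d) IH.
have dn : d * (h ^ 2 * E) <= n * (h ^ 2 * E) by rewrite leq_mul2r nE leq_addl orbT.
have -> : n * (n * E) = d * (n * E) + h * (n * E) by rewrite -mulnDl [d + h]addnC -nE.
have -> : n * (F * d) = d * (n * F) by rewrite mulnA mulnC.
apply: leq_trans (leq_add IHd (leqnn _)) _.
rewrite mulnDr -addnA leq_add2l; apply: leq_trans (leq_add dn (leqnn _)) _.
have -> : n * (h ^ 2 * E) + h * (n * E) = (h ^ 2 + h) * (n * E) by ring.
by rewrite leq_mul2r; apply/orP; right; nia.
Qed.

Local Open Scope ring_scope.

Lemma sum_card_cons (T : finType) k (P : pred (seq T)) :
  #|[set s : k.+1.-tuple T | P s]|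
  = (\sum_(s : k.-tuple T) #|[set x | P (x :: s)]|)%N.
Proof.
under eq_bigr do rewrite -sum1dep_card.
rewrite pair_big_dep /= -sum1dep_card.
rewrite (reindex (fun p : k.-tuple T * T => [tuple of p.2 :: p.1])) //.
exists (fun s : k.+1.-tuple T => ([tuple of behead s], thead s)) => [[s x] _|s _].
  by congr pair; apply: val_inj.
by rewrite /= -tuple_eta.
Qed.

Lemma sum_card_family (W S T : finType) (P : T -> pred S) :
  (\sum_(a : {ffun W -> T}) #|[set s | [forall w, P (a w) s]]|
   = \sum_s #|[set x | P x s]| ^ #|W|)%N.
Proof.
under [LHS]eq_bigr do rewrite -sum1dep_card.
rewrite (exchange_big_dep predT) //=; apply: eq_bigr => s _.
rewrite sum1dep_card -card_ffun_on; apply: eq_card => a; rewrite inE.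
apply/forallP/ffun_onP => aP w; first by rewrite inE; exact: aP.
by have := aP w; rewrite inE.
Qed.

(** A crude substitute for Jensen's inequality, losing only a constant factor when
    [l] is half the mean of [f]. It holds termwise: a term with [f s < l] has
    nonpositive left side, and otherwise [l <= f s <= n]. *)
Lemma truncated_mean (R : realFieldType) (S : finType) (f : S -> R) (n l : R) w :
  0 <= l -> (forall s, 0 <= f s <= n) ->
  l ^+ w * (\sum_s f s - l * #|S|%:R) <= n * \sum_s f s ^+ w.
Proof.
move=> l0 fn.
have -> : l * #|S|%:R = \sum_(s : S) l by rewrite sumr_const mulr_natr.
rewrite -sumrB !mulr_sumr; apply: ler_sum => s _.
have /andP[f0 fle] := fn s; have [lf|fl] := leP l (f s).
  rewrite mulrC; apply: ler_pM; rewrite ?subr_ge0 ?exprn_ge0 //.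
    by rewrite lerBlDr; apply: le_trans fle _; rewrite lerDl.
  by rewrite lerXn2r ?nnegrE.
apply: (@le_trans _ _ 0); last by rewrite mulr_ge0 ?exprn_ge0 ?(le_trans f0).
by rewrite mulr_ge0_le0 ?exprn_ge0 // subr_le0 ltW.
Qed.

(** A dense bipartite incidence between [T] and [S] has a [#|W|]-element subset of
    [T] with a positive proportion of common neighbours in [S]. By [truncated_mean],
    the average over all maps [a : W -> T] of that proportion is at least
    [(c / 2) ^+ #|W|.+1]; once [#|T|] is large, the maps that are not
    injective contribute less than half of it. *)
Lemma dense_common_link (R : realFieldType) (W S T : finType) (P : T -> pred S) (c d : R) :
  let n := #|T|%:R in
  (0 < #|S|)%N -> 0 < c -> (0 < n :> R) ->
  2 * d = (c / 2) ^+ #|W|.+1 -> (#|W| ^ 2)%:R < d * n ->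
  c * n * #|S|%:R <= (\sum_s #|[set x | P x s]|)%:R ->
  exists a : {ffun W -> T}, injective a /\
    d * #|S|%:R <= #|[set s | [forall w, P (a w) s]]|%:R.
Proof.
move=> n S0 c0 n0 dE nbig Pbig; set w := #|W| in dE nbig.
pose N (a : {ffun W -> T}) := #|[set s | [forall w, P (a w) s]]|.
have [/existsP[a /andP[/injectiveP aI aN]]|] :=
  boolP [exists a : {ffun W -> T}, injectiveb a && (d * #|S|%:R <= (N a)%:R)].
  by exists a.
rewrite negb_exists => /forallP few; exfalso.
have d0 : 0 < d by have : 0 < 2 * d; [rewrite dE exprn_gt0 // divr_gt0 | rewrite pmulr_rgt0].
pose J := #|[set a : {ffun W -> T} | injectiveb a]|.
have JE : J = (#|T| ^_ w)%N by exact: card_inj_ffuns.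
have JC : (J + #|[set a : {ffun W -> T} | ~~ injectiveb a]|)%N = (#|T| ^ w)%N.
  rewrite -card_ffun -(cardC [set a : {ffun W -> T} | injectiveb a]); congr addn.
  by apply: eq_card => a; rewrite !inE.
set J' := #|_| in JC.
have upper : (\sum_a N a)%:R <= J%:R * (d * #|S|%:R) + J'%:R * #|S|%:R.
  rewrite natr_sum (bigID (fun a : {ffun W -> T} => injectiveb a)) /=.
  rewrite /J /J' -!sum1dep_card !natr_sum !mulr_suml; apply: lerD; apply: ler_sum => a aI.
    by rewrite mul1r; move: (few a); rewrite aI /= -ltNge => /ltW.
  by rewrite mul1r ler_nat max_card.
(* The truncation level is half of the mean [c * n] of the degrees. *)
have lower : 2 * d * n ^+ w * n * #|S|%:R <= n * (\sum_a N a)%:R.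
  have l0 : 0 <= c * n / 2 by rewrite divr_ge0 // mulr_ge0 ?ltW.
  have fn s : 0 <= (#|[set x | P x s]|%:R : R) <= n by rewrite ler0n ler_nat max_card.
  have := truncated_mean w l0 fn.
  rewrite sum_card_family !natr_sum; under [X in _ <= n * X]eq_bigr do rewrite -natrX.
  apply: le_trans.
  have -> : 2 * d * n ^+ w * n * #|S|%:R = (c * n / 2) ^+ w * (c * n / 2 * #|S|%:R).
    rewrite dE exprS [c * n / 2]mulrAC !exprMn; ring.
  rewrite ler_wpM2l ?exprn_ge0 // -natr_sum lerBrDr -mulrDl.
  by rewrite (_ : c * n / 2 + c * n / 2 = c * n) //; field.
have gap : n * J'%:R <= (w ^ 2)%:R * n ^+ w.
  rewrite -natrX -!natrM ler_nat; have := expn_ffact_gap #|T| w.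
  by rewrite -JC -JE mulnDr leq_add2l.
have S0' : (0 : R) < #|S|%:R by rewrite ltr0n.
have Jn : J%:R <= n ^+ w by rewrite -natrX ler_nat -JC leq_addr.
have nw0 : 0 < n ^+ w by rewrite exprn_gt0.
have : 2 * d * n ^+ w * n * #|S|%:R < 2 * d * n ^+ w * n * #|S|%:R.
  apply: (le_lt_trans lower).
  apply: (@le_lt_trans _ _ ((n * J%:R * d + n * J'%:R) * #|S|%:R)).
    apply: le_trans (ler_wpM2l (ltW n0) upper) _.
    by rewrite le_eqVlt; apply/orP; left; apply/eqP; ring.
  rewrite ltr_pM2r //.
  apply: (@le_lt_trans _ _ (n * n ^+ w * d + (w ^ 2)%:R * n ^+ w)).
    by apply: lerD => //; rewrite ler_pM2r // ler_pM2l.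
  rewrite (_ : 2 * d * n ^+ w * n = n * n ^+ w * d + (d * n) * n ^+ w); last by ring.
  by rewrite ltrD2l ltr_pM2r.
by rewrite ltxx.
Qed.

(** Erdos's theorem on complete [k]-partite [k]-uniform hypergraphs. Induction on
    [k]: regard a [k.+1]-tuple as an incidence between its head and its tail,
    choose the first side of the box by [dense_common_link], and apply the
    induction hypothesis to the tails that are compatible with all of it. The
    sides are given as injections [p i] of [W]; [p i] for [i >= k] is junk. *)
Lemma box_of_positive_density (R : archiRealFieldType) (W : finType) k (c : R) :
  0 < c -> exists n0 : nat, forall (T : finType) (P : pred (seq T)),
    (n0 <= #|T|)%N ->
    c * #|T|%:R ^+ k <= #|[set s : k.-tuple T | P s]|%:R ->
    exists p : nat -> W -> T,
      (forall i, (i < k)%N -> injective (p i)) /\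
      forall sigma : nat -> W, P (mkseq (fun i => p i (sigma i)) k).
Proof.
elim: k c => [|k IH] c c0.
  exists 1 => T P /card_gt0P[x _] cP; exists (fun _ _ => x); split=> // _.
  have /card_gt0P[s] : (0 < #|[set s : 0.-tuple T | P s]|)%N.
    by rewrite -(ltr_nat R); apply: lt_le_trans cP; rewrite expr0 mulr1.
  by rewrite inE (tuple0 s).
pose d : R := (c / 2) ^+ #|W|.+1 / 2.
have d0 : 0 < d by rewrite divr_gt0 // exprn_gt0 // divr_gt0.
have [n0 n0P] := IH d d0.
exists (maxn n0 (Num.bound ((#|W| ^ 2)%:R / d)).+1) => T P.
rewrite geq_max => /andP[n0T TW] cP.
have T0 : (0 < #|T|)%N by apply: leq_trans TW.
have [||||||a [aI aN]] := @dense_common_link R W (k.-tuple T) T (fun x s => P (x :: s)) c d.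
- by rewrite card_tuple expn_gt0 T0.
- by [].
- by rewrite ltr0n.
- by rewrite /d; field.
- rewrite mulrC -ltr_pdivrMr //; apply: lt_le_trans (archi_boundP _) _.
    by rewrite divr_ge0 ?ler0n // ltW.
  by rewrite ler_nat ltnW.
- by rewrite -sum_card_cons card_tuple natrX -mulrA -exprS.
rewrite card_tuple natrX in aN.
have [p [pI pP]] := n0P T (fun s => [forall w, P (a w :: s)]) n0T aN.
exists (fun i => if i is j.+1 then p j else a : W -> T); split; first by case.
move=> sigma; have /forallP/(_ (sigma 0%N)) := pP (sigma \o succn).
by rewrite /mkseq /= (iotaDl 1 0) -map_comp.
Qed.

(** * Cliques in graphs without F *)

(** The copy of [F] uses the point with index [x] of the side [chi x] for the vertex
    [x]. Vertices of different colours go to adjacent, hence distinct, points. *)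
Lemma blowup_not_free (W T : finType) (F : sgraph W) (G : sgraph T) k
    (chi : W -> 'I_k) (p : nat -> W -> T) :
  (forall x y, adj F x y -> chi x != chi y) ->
  (forall i, (i < k)%N -> injective (p i)) ->
  (forall sigma, pairwise (adj G) (mkseq (fun i => p i (sigma i)) k)) ->
  ~~ Defs.free F G.
Proof.
move=> chiF pI pG.
have pA x y : chi x != chi y -> adj G (p (chi x) x) (p (chi y) y).
  wlog xy : x y / (chi x < chi y)%N.
    move=> wl; rewrite neq_ltn => /orP[] lt; first by apply: wl; rewrite // neq_ltn lt.
    by rewrite adj_sym; apply: wl; rewrite // neq_ltn lt.
  (* A transversal of the box through the two points in question. *)
  move=> _; have := pG (fun i => if i == chi x :> nat then x else y).
  move/(pairwiseP (p 0%N x))/(_ (chi x) (chi y)).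
  rewrite !inE size_mkseq !nth_mkseq // eqxx.
  by rewrite -[(chi y == chi x :> nat)]negbK neq_ltn xy orbT /=; apply.
rewrite freeE; apply/set0Pn; exists [ffun x => p (chi x) x].
apply/embeddingP; split=> [x y|x y xy]; rewrite !ffunE; last exact/pA/chiF.
have [xy|/pA/adj_neq/eqP //] := eqVneq (chi x) (chi y).
by rewrite xy; apply: pI.
Qed.

Lemma free_few_cliques (R : archiRealFieldType) (W : finType) (F : sgraph W) k (c : R) :
  colorable F k -> 0 < c ->
  exists n0 : nat, forall (T : finType) (G : sgraph T), (n0 <= #|T|)%N ->
    Defs.free F G -> #|embeddings (complete k) G|%:R <= c * #|T|%:R ^+ k.
Proof.
move=> /existsP[chi /forallP chiF] c0; have [n0 n0P] := box_of_positive_density W k c0.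
exists n0 => T G nT FG; rewrite leNgt; apply/negP => many.
have [|p [pI pG]] := n0P T (fun s => pairwise (adj G) s) nT; last first.
- move: FG; apply/negP; apply: (blowup_not_free (chi := chi)) pI pG => x y.
  by have /forallP/(_ y)/implyP := chiF x.
apply: le_trans (ltW many) _; rewrite ler_nat.
pose t (f : {ffun 'I_k -> T}) := [tuple f i | i < k].
have tI : injective t.
  move=> f g /(congr1 (fun s => tnth s)) fg; apply/ffunP => i.
  by have := congr1 (@^~ i) fg; rewrite !tnth_mktuple.
rewrite -(card_imset _ tI); apply: subset_leq_card.
apply/subsetP => _ /imsetP[f /embeddingP[_ fG] ->]; rewrite inE.
rewrite /= pairwise_map; apply: sub_pairwise (_ : pairwise (fun i j => i != j) _).
  by move=> i j ij; apply: fG; rewrite adj_complete.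
by rewrite -uniq_pairwise enum_uniq.
Qed.

(** * The asymptotic comparison *)

(** The ratios [rho m] are compared through their infimum [D]: sampling at a fixed
    [m] with [rho m < D + d] bounds the density of [H] from above by [D + 2 * d],
    while [D <= rho n] bounds [ex_copies n H (complete k)] from below. The last
    [d] pays for replacing [n ^_ h] by [n ^ h]. *)
Lemma ex_copies_asymptotics (R : realType) (V W : finType) (H : sgraph V)
    (F : sgraph W) k (eps : R) :
  colorable F k -> 0 < eps ->
  exists n0 : nat, forall n, (n0 <= n)%N ->
    (ex_copies n H F)%:R <= (ex_copies n H (complete k))%:R + eps * n%:R ^+ #|V| :> R.
Proof.
move=> Fk eps0; set h := #|V|.
pose e n := (num_aut H * ex_copies n H (complete k))%N.
pose rho n : R := (e n)%:R / (n ^_ h)%:R.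
pose E : set R := [set rho m | m in [set m | (h <= m)%N]]%classic.
have rho_ge0 m : 0 <= rho m by rewrite divr_ge0 ?ler0n.
have infE : has_inf E.
  split; first by exists (rho h), h => /=.
  by exists 0 => _ [m _ <-].
set D := inf E.
have Dle m : (h <= m)%N -> D <= rho m by move=> hm; apply: ge_inf; [case: infE | exists m].
have D0 : 0 <= D by apply: lb_le_inf; [case: infE | move=> _ [m _ <-]].
pose d := eps / 3.
have d0 : 0 < d by rewrite divr_gt0.
have [_ [m /= hm <-] mD] := inf_adherent d0 infE; rewrite -/D in mD.
have M0 : (0 : R) < (m ^_ h)%:R by rewrite ltr0n ffact_gt0.
(* The clique density must beat the [m ^_ k] places in the sample; adding one
   avoids a division by zero when [m < k]. *)
pose c : R := d / ((m ^_ k)%:R + 1).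
have K0 : (0 : R) < (m ^_ k)%:R + 1 by rewrite ltr_wpDl ?ler0n.
have [n1 n1P] := free_few_cliques Fk (divr_gt0 d0 K0 : 0 < c).
exists (maxn (maxn n1 h) (Num.bound (D * (h ^ 2)%:R / d)).+1) => n.
rewrite !geq_max => /andP[/andP[n1n hn] bn].
have n0 : (0 : R) < n%:R by rewrite ltr0n; apply: leq_trans bn.
have big : D * (h ^ 2)%:R <= d * n%:R.
  rewrite mulrC [d * _]mulrC -ler_pdivrMr // [_ * D]mulrC; apply: ltW.
  apply: lt_le_trans (archi_boundP _) _.
    by rewrite divr_ge0 ?mulr_ge0 ?ler0n // ltW.
  by rewrite ler_nat ltnW.
have lower : D * n%:R ^+ h <= (e n)%:R + d * n%:R ^+ h.
  have gap := expn_ffact_gap n h.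
  rewrite -(ler_nat R) natrD !natrM natrX in gap.
  have De : D * (n ^_ h)%:R <= (e n)%:R by rewrite -ler_pdivlMr ?ltr0n ?ffact_gt0 // Dle.
  rewrite -(ler_pM2l n0).
  have nh0 : (0 : R) <= n%:R ^+ h by rewrite exprn_ge0 ?ler0n.
  have := ler_wpM2l D0 gap; have := ler_wpM2l (ltW n0) De; have := ler_wpM2r nh0 big.
  rewrite !natrX !mulrDr !mulrA ![_ * n%:R]mulrC !mulrA; lra.
have X0 : (0 : R) <= (ex_copies n H (complete k))%:R + eps * n%:R ^+ h.
  by rewrite addr_ge0 ?mulr_ge0 ?exprn_ge0 ?ler0n // ltW.
rewrite {1}/ex_copies.
elim/big_ind: _ => [//|x y xX yX|G FG]; first by rewrite /maxn; case: ifP.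
have few := n1P _ G (_ : n1 <= #|'I_n|)%N FG.
rewrite card_ord in few; have {}few := few n1n.
have avg := @embedding_averaging V 'I_n H G m k.
rewrite card_ord -/h -/(e m) card_embeddings in avg.
have {}avg := avg (leq_trans (ltn0Sn _) bn).
rewrite -(ler_nat R) !natrM natrD !natrM !natrX in avg.
set N : R := #|_|%:R in few avg; set C : R := #|_|%:R in avg *.
set a : R := (num_aut H)%:R in avg; set M : R := (m ^_ h)%:R in M0 avg.
clear n1P n1n; rewrite /c in few; set K : R := (m ^_ k)%:R in K0 few avg.
have a1 : 1 <= a by rewrite ler1n num_aut_gt0.
have nk0 : 0 < n%:R ^+ k :> R by rewrite exprn_gt0.
have nh0 : 0 < n%:R ^+ h :> R by rewrite exprn_gt0.
have KN : K * N <= d * n%:R ^+ k.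
  apply: le_trans (ler_wpM2l (ler0n _ _) few) _; rewrite mulrA ler_pM2r //.
  by rewrite mulrA ler_pdivrMr // mulrC ler_pM2l // lerDl.
have em : (e m)%:R <= (D + d) * M by rewrite -ler_pdivrMr // ltW.
have upper : a * C <= n%:R ^+ h * (D + 2 * d).
  rewrite -(ler_pM2l M0) -(ler_pM2r nk0); apply: le_trans avg _.
  have -> : M * (n%:R ^+ h * (D + 2 * d)) * n%:R ^+ k
    = n%:R ^+ h * (n%:R ^+ k * ((D + d) * M) + d * n%:R ^+ k * M) by ring.
  rewrite ler_pM2l //; apply: lerD; last by rewrite ler_pM2r.
  by rewrite ler_pM2l //; move: em; rewrite natrM.
rewrite natrM -/a in lower; set X : R := (ex_copies _ _ _)%:R in lower *.
have diff : a * (C - X) <= eps * n%:R ^+ h.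
  have -> : eps = 3 * d by rewrite /d; field.
  rewrite mulrBr lerBlDl; apply: le_trans upper _.
  have -> : n%:R ^+ h * (D + 2 * d) = D * n%:R ^+ h + 2 * d * n%:R ^+ h by ring.
  have -> : a * X + 3 * d * n%:R ^+ h = a * X + d * n%:R ^+ h + 2 * d * n%:R ^+ h by ring.
  by rewrite lerD2r.
rewrite addrC -lerBlDr; case: (leP 0 (C - X)) => [CX|/ltW CX].
  by apply: le_trans diff; rewrite ler_peMl.
by apply: le_trans CX _; rewrite mulr_ge0 // ltW.
Qed.

Local Open Scope classical_set_scope.
Local Open Scope ring_scope.

Theorem theorem2 (R : realType) (V W : finType) (H : sgraph V) (F : sgraph W)
    (k : nat) :
  chromatic_number F = k ->
  exists r : nat -> R,
    r =o_\oo (fun n : nat => (n%:R : R) ^+ #|V|) /\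
    forall n : nat,
      ((ex_copies n H F)%:R : R) <= (ex_copies n H (complete k))%:R + r n.
Proof.
move=> Fk; have {}Fk : colorable F k.
  by move: Fk; rewrite /chromatic_number; case: ex_minnP => m mF _ <-.
(* Truncated subtraction: the error is nonnegative by construction. *)
exists (fun n => (ex_copies n H F - ex_copies n H (complete k))%:R); split; last first.
  by move=> n; rewrite -natrD ler_nat -leq_subLR.
apply/eqoP => eps eps0; have [n0 n0P] := ex_copies_asymptotics H Fk eps0.
exists n0 => // n /= n0n.
rewrite ger0_norm ?ler0n // ger0_norm ?exprn_ge0 ?ler0n //.
have := n0P n n0n.
case: (leqP (ex_copies n H F) (ex_copies n H (complete k))) => [/eqP-> _|lt].
  by rewrite mulr_ge0 ?exprn_ge0 ?ler0n // ltW.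
by rewrite natrB ?(ltnW lt) // lerBlDl.
Qed.
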